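(* Let $c_1,c_2,c_3$ be nonzero real constants and let $l_1,l_2,l_3,n\ge1$ be integers such that $l_k$ divides $n$ for $k=1,2,3$. For $k=1,2,3$ let $\boldsymbol a_k$ and $\boldsymbol b_k$ be real tuples of sizes $i_k\ge 0$ and $j_k\ge 0$ respectively, and assume that $${}_{j_1}F_{i_1}\left(\begin{smallmatrix}-n\boldsymbol b_1\\ -n\boldsymbol a_1\end{smallmatrix};c_1x^{l_1}\right)\,{}_{j_2}F_{i_2}\left(\begin{smallmatrix}-n\boldsymbol b_2\\ -n\boldsymbol a_2\end{smallmatrix};c_2x^{l_2}\right)={}_{j_3}F_{i_3}\left(\begin{smallmatrix}-n\boldsymbol b_3\\ -n\boldsymbol a_3\end{smallmatrix};c_3x^{l_3}\right).$$ For $k=1,2,3$ consider the polynomials $$p_k(x)=\left((-1)^{i_k+j_k+1}l_k^{l_k}c_k\right)^{n/l_k}\ \mathcal H_{n/l_k}\left[\begin{smallmatrix}l_k\boldsymbol b_k,\ 1-\frac1n,\ \dots,\ 1-\frac{l_k-1}n\\ l_k\boldsymbol a_k\end{smallmatrix}\right]\left(\frac{(-1)^{i_k+j_k+1}}{l_k^{l_k}c_k}x^{l_k}\right).$$ Then $p_1\boxplus_n p_2=p_3$.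
   Context: $\mathcal P_n$ is the set of monic polynomials of degree $n$ over $\mathbb C$. For $p\in\mathcal P_n$ the coefficients $\mathsf e_k(p)$ are defined by $p(x)=\sum_{k=0}^n x^{n-k}(-1)^k\mathsf e_k(p)$. Falling and rising factorials: $(a)^{\underline k}=a(a-1)\cdots(a-k+1)$, $(a)^{\overline k}=a(a+1)\cdots(a+k-1)$. For a tuple $\boldsymbol a=(a_1,\dots,a_i)$, $(\boldsymbol a)^{\overline k}=\prod_s(a_s)^{\overline k}$ and $(\boldsymbol a)^{\underline k}=\prod_s(a_s)^{\underline k}$ (equal to $1$ for the empty tuple), and $c\boldsymbol a=(ca_1,\dots,ca_i)$. Generalized hypergeometric series: ${}_jF_i\left(\begin{smallmatrix}\boldsymbol b\\ \boldsymbol a\end{smallmatrix};x\right)=\sum_{k\ge0}\frac{(\boldsymbol b)^{\overline k}}{(\boldsymbol a)^{\overline k}}\frac{x^k}{k!}$ for tuples $\boldsymbol b$ of size $j$ (upper) and $\boldsymbol a$ of size $i$ (lower), regarded as a formal power series. The assumed identity is an identity of formal power series in $x$ and includes the assumption that the three series are well defined (no denominator vanishes). Hypergeometric polynomials: for a real tuple $\boldsymbol b$ and a real tuple $\boldsymbol a$ with no entry in $\{0,\frac1N,\dots,\frac{N-1}N\}$, $\mathcal H_N\left[\begin{smallmatrix}\boldsymbol b\\ \boldsymbol a\end{smallmatrix}\right]\in\mathcal P_N$ is the monic polynomial with $\mathsf e_k=\binom Nk\frac{(N\boldsymbol b)^{\underline k}}{(N\boldsymbol a)^{\underline k}}$ for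 $0\le k\le N$. A comma inside the bracket denotes concatenation of parameters. When $l_k=1$ the list $1-\frac1n,\dots,1-\frac{l_k-1}n$ is empty. The finite free additive convolution of $p,q\in\mathcal P_n$ is the polynomial $p\boxplus_nq\in\mathcal P_n$ with $\mathsf e_k(p\boxplus_n q)=(n)^{\underline k}\sum_{i+j=k}\frac{\mathsf e_i(p)\mathsf e_j(q)}{(n)^{\underline i}(n)^{\underline j}}$ for $0\le k\le n$. *)

(* Defs.v *)
From HB Require Import structures.
From mathcomp Require Import all_boot all_order all_algebra.
From mathcomp Require Import reals complex.

Set Implicit Arguments.
Unset Strict Implicit.
Unset Printing Implicit Defensive.

Import Order.TTheory GRing.Theory Num.Theory.
Local Open Scope ring_scope.
Local Open Scope complex_scope.

Section Factorials.
Context {K : fieldType}.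
Implicit Types (a c : K) (s : seq K) (k : nat).

Definition falling a k : K := \prod_(i < k) (a - i%:R).
Definition rising a k : K := \prod_(i < k) (a + i%:R).

Definition fallings s k : K := \prod_(a <- s) falling a k.
Definition risings s k : K := \prod_(a <- s) rising a k.

Definition scale_seq c s : seq K := [seq c * a | a <- s].

End Factorials.

(* A formal power series is represented by its sequence of coefficients. *)
Section PowerSeries.
Context {K : fieldType}.

Definition fps_mul (f g : nat -> K) : nat -> K :=
  fun m => \sum_(i < m.+1) f i * g (m - i)%N.

(* f (c x^l), for l > 0 *)
Definition fps_subst (f : nat -> K) (c : K) (l : nat) : nat -> K :=
  fun m => if (l %| m)%N then f (m %/ l)%N * c ^+ (m %/ l) else 0.

(* Upper parameters b come first, then lower parameters a. *)
Definition hypergeo (b a : seq K) : nat -> K :=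
  fun k => risings b k / risings a k / k`!%:R.

Definition hypergeo_defined (a : seq K) : Prop :=
  forall k, risings a k != 0.

End PowerSeries.

Section Polynomials.
Context {K : fieldType}.

(* e_k(p) for p regarded as a polynomial of degree n, and k <= n. *)
Definition ecoef (n : nat) (p : {poly K}) (k : nat) : K :=
  (-1) ^+ k * p`_(n - k).

(* The polynomial of degree at most n with e_k = e k for k <= n. *)
Definition poly_of_ecoef (n : nat) (e : nat -> K) : {poly K} :=
  \sum_(k < n.+1) ((-1) ^+ k * e k) *: 'X^(n - k).

Lemma coef_poly_of_ecoef n e k : (k <= n)%N ->
  (poly_of_ecoef n e)`_(n - k) = (-1) ^+ k * e k.
Proof.
move=> le_kn; rewrite coef_sum (bigD1 (inord k : 'I_n.+1)) //= inordK //.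
rewrite coefZ coefXn eqxx mulr1 big1 ?addr0 // => i ne_ik.
rewrite coefZ coefXn; case: eqP; rewrite ?mulr0 // => eq_nk.
case/eqP: ne_ik; apply: val_inj; rewrite /= inordK //.
by rewrite -(subKn le_kn) eq_nk subKn // -ltnS.
Qed.

Lemma ecoef_poly_of_ecoef n e k : (k <= n)%N ->
  ecoef n (poly_of_ecoef n e) k = e k.
Proof.
by move=> le_kn; rewrite /ecoef coef_poly_of_ecoef // mulrA -expr2 sqrr_sign mul1r.
Qed.

Lemma size_poly_of_ecoef n e : e 0%N = 1 -> size (poly_of_ecoef n e) = n.+1.
Proof.
move=> e0; apply/eqP; rewrite eqn_leq; apply/andP; split.
  apply: (leq_trans (size_sum _ _ _)); apply/bigmax_leqP => i _.
  by apply: leq_trans (size_scale_leq _ _) _; rewrite size_polyXn ltnS leq_subr.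
rewrite ltnNge; apply/negP => /leq_sizeP /(_ n (leqnn n)) /eqP.
by rewrite -[n in _`_n]subn0 coef_poly_of_ecoef // e0 mulr1 oner_eq0.
Qed.

Lemma monic_poly_of_ecoef n e : e 0%N = 1 -> poly_of_ecoef n e \is monic.
Proof.
move=> e0; rewrite monicE lead_coefE size_poly_of_ecoef //=.
by rewrite -[n in _`_n]subn0 coef_poly_of_ecoef // e0 mulr1.
Qed.

Definition ffconv (n : nat) (p q : {poly K}) : {poly K} :=
  poly_of_ecoef n (fun k => (n ^_ k)%:R *
    \sum_(i < k.+1) (ecoef n p i * ecoef n q (k - i)%N) /
                    ((n ^_ i)%:R * (n ^_ (k - i))%:R)).

End Polynomials.

Section HypergeometricPolynomials.
Context {R : realType}.

(* Meaningful when no entry of a is of the form i / N with 0 <= i < N. *)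
Definition hyper_poly (N : nat) (b a : seq R) : {poly R[i]} :=
  poly_of_ecoef N (fun k =>
    ('C(N, k)%:R *
     (fallings (scale_seq N%:R b) k / fallings (scale_seq N%:R a) k))%:C).

Definition extra_params (n l : nat) : seq R :=
  [seq 1 - s%:R / n%:R | s <- iota 1 l.-1].

Definition rescaled_hyper_poly (n l : nat) (c : R) (j i : nat)
    (b : j.-tuple R) (a : i.-tuple R) : {poly R[i]} :=
  (((-1) ^+ (i + j + 1) * l%:R ^+ l * c) ^+ (n %/ l))%:C *:
  (hyper_poly (n %/ l) (scale_seq l%:R b ++ extra_params n l)
                       (scale_seq l%:R a)
     \Po (((-1) ^+ (i + j + 1) / (l%:R ^+ l * c))%:C *: 'X^l)).

End HypergeometricPolynomials.

(* Main.v *)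
Require Import Defs.
From mathcomp Require Import all_boot all_order all_algebra.
From mathcomp Require Import reals complex ring.

(** The whole statement is carried by one coefficient computation: with [F] the
power series [_jF_i(c x^l)], the associated polynomial [p] satisfies
[e_m(p) = (-1)^m (n)_m F[m]] for all [m <= n], where [(n)_m] is the falling
factorial ([rescaled_hyper_polyE]).  Finite free convolution multiplies
the generating series of [e_m(p) / (n)_m], and the signs [(-1)^m] are
multiplicative in [m], so it corresponds to the product of power series
([ffconv_signed_ffact]).

The coefficient computation rests on two facts.  Passing from rising factorials
of [- n a] to falling factorials of [n a] costs a sign [(-1)^k] per parameter,
which explains the factor [(-1)^(i+j)].  And with [N = n / l], the binomial
coefficient together with the extra parameters [1 - s/n] gives
[(N)_k * prod_(1 <= s < l) (N - s/l)_k = (n)_(l k) / l^(l k)], the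
multiplication formula for falling factorials ([falling_multiplication]). *)

Set Implicit Arguments.
Unset Strict Implicit.
Unset Printing Implicit Defensive.

Import Order.TTheory GRing.Theory Num.Theory.
Local Open Scope ring_scope.

Section FallingFactorials.
Context {K : fieldType}.
Implicit Types (x : K) (s : seq K) (k l n : nat).

Lemma fallingS x k : falling x k.+1 = falling x k * (x - k%:R).
Proof. by rewrite /falling big_ord_recr. Qed.

Lemma natr_ffact n k : (n ^_ k)%:R = falling n%:R k :> K.
Proof.
elim: k => [|k IHk]; first by rewrite /falling big_ord0.
rewrite ffactnSr natrM fallingS -IHk.
case: (leqP k n) => [le_kn | lt_nk]; first by rewrite natrB.
by rewrite ffact_small // !mul0r.
Qed.

Lemma risingN x k : rising (- x) k = (-1) ^+ k * falling x k.
Proof.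
rewrite /rising /falling; under eq_bigr => i _ do rewrite addrC -opprB.
by rewrite prodrN card_ord.
Qed.

Lemma risings_scaleN (c : K) s k :
  risings (scale_seq (- c) s) k
  = (-1) ^+ (size s * k) * fallings (scale_seq c s) k.
Proof.
rewrite /risings /fallings /scale_seq.
elim: s => [|a s IHs] /=; first by rewrite !big_nil mulr1.
by rewrite !big_cons IHs mulNr risingN mulSn exprD mulrACA.
Qed.

(** The factors [x - t], [t < l k], are grouped by the residue [s] of [t]
modulo [l]. *)
Lemma falling_multiplication x l k : l%:R != 0 :> K ->
  falling x (l * k) =
  l%:R ^+ (l * k) * \prod_(s < l) falling ((x - s%:R) / l%:R) k.
Proof.
move=> l_neq0; elim: k => [|k IHk].
  by rewrite muln0 /falling big_ord0 mul1r big1 // => s _; rewrite big_ord0.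
under eq_bigr => s _ do rewrite fallingS.
rewrite big_split /= mulnSr exprD mulrACA -IHk.
rewrite {1}/falling big_split_ord /=; congr (_ * _).
rewrite -[X in _ ^+ X]card_ord -prodr_const -big_split /=.
apply: eq_bigr => s _; rewrite mulrBr mulrCA divff // mulr1.
by rewrite natrD natrM opprD addrA addrAC.
Qed.

End FallingFactorials.

Section Coefficients.
Context {K : fieldType}.
Implicit Types (e f : nat -> K) (k l n : nat).

Lemma eq_poly_of_ecoef n e f :
  (forall k, (k <= n)%N -> e k = f k) ->
  poly_of_ecoef n e = poly_of_ecoef n f.
Proof. by move=> eq_ef; apply: eq_bigr => k _; rewrite eq_ef // -ltnS. Qed.

(** Substituting [d x^l] stretches the index of the coefficients by [l]; the
prefactor [c ^ N] with [c d = 1] turns [d ^ (N - k)] into [c ^ k]. *)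
Lemma poly_of_ecoef_comp N l (c d : K) e : (0 < l)%N -> c * d = 1 ->
  c ^+ N *: (poly_of_ecoef N e \Po (d *: 'X^l)) =
  poly_of_ecoef (N * l) (fun m => if (l %| m)%N then
     (-1) ^+ m * ((-1) ^+ (m %/ l) * c ^+ (m %/ l) * e (m %/ l)%N) else 0).
Proof.
move=> l_gt0 cd1; rewrite /poly_of_ecoef raddf_sum /= scaler_sumr.
transitivity (\sum_(k < N.+1)
    ((-1) ^+ k * c ^+ k * e k) *: 'X^(N * l - k * l) : {poly K}).
  apply: eq_bigr => k _; have le_kN : (k <= N)%N by rewrite -ltnS.
  rewrite comp_polyZ comp_Xn_poly exprZn -exprM !scalerA mulnC mulnBl.
  congr (_ *: _); rewrite -{1}(subnKC le_kN) exprD.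
  (* Multiply one side by 1 = (c d)^(N - k). *)
  rewrite -(mulr1 (_ * _ * e k)) -(expr1n K (N - k)) -cd1 exprMn.
  by ring.
(* Only the multiples m = k l of l contribute on the right. *)
rewrite [RHS](bigID (fun m : 'I_(N * l).+1 => l %| m)%N) /=.
rewrite addrC [X in _ = X + _]big1; last first.
  by move=> m l_ndvd_m; rewrite ifN // mulr0 scale0r.
have kl_le (k : 'I_N.+1) : (k * l < (N * l).+1)%N.
  by rewrite ltnS leq_mul2r -ltnS ltn_ord orbT.
have ml_le (m : 'I_(N * l).+1) : (m %/ l < N.+1)%N.
  by rewrite ltnS -[leqRHS](mulnK N l_gt0) leq_div2r // -ltnS.
rewrite add0r (reindex_onto (fun k : 'I_N.+1 => Ordinal (kl_le k))
                      (fun m => Ordinal (ml_le m))) /=; last first.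
  by move=> m l_dvd_m; apply: val_inj; rewrite /= divnK.
apply: eq_big => [k|k _]; last first.
  by rewrite dvdn_mull // mulnK // !mulrA -expr2 sqrr_sign mul1r.
by rewrite dvdn_mull // -val_eqE /= mulnK // eqxx.
Qed.

(** On coefficients of the form [(-1)^k (n)_k F[k]], finite free convolution is
multiplication of the power series [F]. *)
Lemma ffconv_signed_ffact n e f :
  (forall k, (k <= n)%N -> (n ^_ k)%:R != 0 :> K) ->
  ffconv n (poly_of_ecoef n (fun k => (-1) ^+ k * (n ^_ k)%:R * e k))
           (poly_of_ecoef n (fun k => (-1) ^+ k * (n ^_ k)%:R * f k))
  = poly_of_ecoef n (fun k => (-1) ^+ k * (n ^_ k)%:R * fps_mul e f k).
Proof.
move=> ffact_neq0; apply: eq_poly_of_ecoef => k le_kn.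
rewrite [_ ^+ k * _]mulrC -mulrA /fps_mul; congr (_ * _).
rewrite mulr_sumr.
apply: eq_bigr => i _; have le_ik : (i <= k)%N by rewrite -ltnS.
have le_in := leq_trans le_ik le_kn.
have le_kin : (k - i <= n)%N := leq_trans (leq_subr i k) le_kn.
have -> : (-1) ^+ k = (-1) ^+ i * (-1) ^+ (k - i) :> K by rewrite -exprD subnKC.
rewrite !ecoef_poly_of_ecoef //.
by field; rewrite !ffact_neq0.
Qed.

End Coefficients.

Section RescaledHypergeometricPolynomials.
Context {R : realType}.
Local Open Scope complex_scope.
Implicit Types (c x : R) (b a s : seq R) (k l n N : nat).

Lemma fallings_cat s1 s2 k :
  fallings (s1 ++ s2) k = fallings s1 k * fallings s2 k :> R.
Proof. by rewrite /fallings big_cat. Qed.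

Lemma scale_scale_seq c x s : scale_seq c (scale_seq x s) = scale_seq (c * x) s.
Proof. by rewrite /scale_seq -map_comp; apply: eq_map => y /=; rewrite mulrA. Qed.

(** The leading factor [(N)_k], which comes from the binomial coefficient, is
the missing [s = 0] term of the product over the extra parameters. *)
Lemma fallings_extra_params N l k : (0 < N)%N -> (0 < l)%N ->
  l%:R ^+ (l * k) *
    (falling N%:R k * fallings (scale_seq N%:R (extra_params (N * l) l)) k)
  = ((N * l) ^_ (l * k))%:R :> R.
Proof.
move=> N_gt0 l_gt0.
have N_neq0 : N%:R != 0 :> R by rewrite pnatr_eq0 -lt0n.
have l_neq0 : l%:R != 0 :> R by rewrite pnatr_eq0 -lt0n.
rewrite natr_ffact falling_multiplication //; congr (_ * _).
rewrite -(big_mkord xpredT (fun t => falling (((N * l)%:R - t%:R) / l%:R) k)).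
rewrite big_ltn // subr0 natrM mulfK //; congr (_ * _).
rewrite /fallings /scale_seq /extra_params -map_comp big_map /index_iota subn1.
apply: eq_bigr => s _; congr falling => /=.
by rewrite natrM; field; rewrite l_neq0.
Qed.

(** The left side is the coefficient of [x^(n - l k)] in the rescaled
hypergeometric polynomial, where [n = N l]; the right side is [(n)_(l k)] times
the coefficient of [x^(l k)] in the series.  The factor coming from [a] changes
only by a sign inside the inverse, so with [0^-1 = 0] the identity holds even
where that factor vanishes. *)
Lemma hyper_ecoef_hypergeo N l c k b a : (0 < N)%N -> (0 < l)%N ->
  (-1) ^+ k * ((-1) ^+ (size a + size b + 1) * l%:R ^+ l * c) ^+ k *
  ('C(N, k)%:R *
    (fallings (scale_seq N%:R (scale_seq l%:R b ++ extra_params (N * l) l)) k /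
     fallings (scale_seq N%:R (scale_seq l%:R a)) k))
  = ((N * l) ^_ (l * k))%:R *
    (hypergeo (scale_seq (- (N * l)%:R) b) (scale_seq (- (N * l)%:R) a) k
     * c ^+ k).
Proof.
move=> N_gt0 l_gt0.
have kfact_neq0 : k`!%:R != 0 :> R by rewrite pnatr_eq0 -lt0n fact_gt0.
have -> : 'C(N, k)%:R = falling N%:R k / k`!%:R :> R.
  by rewrite -natr_ffact -bin_ffact natrM mulfK.
rewrite {1}/scale_seq map_cat -!/(scale_seq _ _) fallings_cat !scale_scale_seq.
rewrite -!natrM -fallings_extra_params // /hypergeo !risings_scaleN.
rewrite invfM -exprVn invrN1 !exprMn -!exprM addn1 mulSn mulnDl !exprD.
have sgn : (-1) ^+ k * (-1) ^+ k = 1 :> R by rewrite -expr2 sqrr_sign.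
transitivity (((-1) ^+ k * (-1) ^+ k) * ((-1) ^+ (size a * k) *
  (-1) ^+ (size b * k) * l%:R ^+ (l * k) * c ^+ k * (falling N%:R k / k`!%:R *
  (fallings (scale_seq (N * l)%:R b) k *
   fallings (scale_seq N%:R (extra_params (N * l) l)) k /
   fallings (scale_seq (N * l)%:R a) k))) : R); first by ring.
by rewrite sgn; ring.
Qed.

(** The rescaled hypergeometric polynomial is the one with coefficients
[(-1)^m (n)_m F[m]], where [F] is the hypergeometric series in [c x^l]. *)
Lemma rescaled_hyper_polyE n l c j i (b : j.-tuple R) (a : i.-tuple R) :
  c != 0 -> (0 < l)%N -> (0 < n)%N -> (l %| n)%N ->
  rescaled_hyper_poly n l c b a =
  poly_of_ecoef n (fun m => (-1) ^+ m * (n ^_ m)%:R *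
    (fps_subst (hypergeo (scale_seq (- n%:R) b) (scale_seq (- n%:R) a)) c l m)%:C).
Proof.
move=> c_neq0 l_gt0 n_gt0 /dvdnP[N def_n]; rewrite def_n in n_gt0 *.
have N_gt0 : (0 < N)%N by move: n_gt0; rewrite muln_gt0 => /andP[].
have l_neq0 : l%:R != 0 :> R by rewrite pnatr_eq0 -lt0n.
have scale_inv : ((-1) ^+ (i + j + 1) * l%:R ^+ l * c) *
    ((-1) ^+ (i + j + 1) / (l%:R ^+ l * c)) = 1 :> R.
  rewrite -[X in X * _]mulrA mulrACA -expr2 sqrr_sign mul1r divff //.
  by rewrite mulf_neq0 ?expf_neq0.
rewrite /rescaled_hyper_poly mulnK // rmorphXn poly_of_ecoef_comp //; last first.
  by rewrite -rmorphM scale_inv rmorph1.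
apply: eq_poly_of_ecoef => m _; rewrite /fps_subst.
case: ifP => [/dvdnP[k ->]|_]; last by rewrite mulr0.
rewrite mulnK // -[RHS]mulrA; congr (_ * _).
rewrite -(rmorph_nat (real_complex R)) -(rmorph_sign (real_complex R)).
rewrite -rmorphXn -!rmorphM /=; congr (_%:C).
have := hyper_ecoef_hypergeo c k b a N_gt0 l_gt0.
by rewrite !size_tuple [(l * k)%N]mulnC.
Qed.

End RescaledHypergeometricPolynomials.

Theorem theorem4p6 (R : realType) (c1 c2 c3 : R) (l1 l2 l3 n : nat)
  (i1 i2 i3 j1 j2 j3 : nat)
  (a1 : i1.-tuple R) (a2 : i2.-tuple R) (a3 : i3.-tuple R)
  (b1 : j1.-tuple R) (b2 : j2.-tuple R) (b3 : j3.-tuple R)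
  (hc1 : c1 != 0) (hc2 : c2 != 0) (hc3 : c3 != 0)
  (hl1 : (0 < l1)%N) (hl2 : (0 < l2)%N) (hl3 : (0 < l3)%N) (hn : (0 < n)%N)
  (hd1 : (l1 %| n)%N) (hd2 : (l2 %| n)%N) (hd3 : (l3 %| n)%N)
  (hF1 : hypergeo_defined (scale_seq (- n%:R) a1))
  (hF2 : hypergeo_defined (scale_seq (- n%:R) a2))
  (hF3 : hypergeo_defined (scale_seq (- n%:R) a3))
  (hF : forall m : nat,
     fps_mul
       (fps_subst (hypergeo (scale_seq (- n%:R) b1) (scale_seq (- n%:R) a1)) c1 l1)
       (fps_subst (hypergeo (scale_seq (- n%:R) b2) (scale_seq (- n%:R) a2)) c2 l2) m
     = fps_subst (hypergeo (scale_seq (- n%:R) b3) (scale_seq (- n%:R) a3)) c3 l3 m) :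
  ffconv n (rescaled_hyper_poly n l1 c1 b1 a1) (rescaled_hyper_poly n l2 c2 b2 a2)
  = rescaled_hyper_poly n l3 c3 b3 a3.
Proof.
rewrite !rescaled_hyper_polyE // ffconv_signed_ffact => [|k le_kn]; last first.
  by rewrite pnatr_eq0 -lt0n ffact_gt0.
apply: eq_poly_of_ecoef => m _; rewrite -hF /fps_mul rmorph_sum; congr (_ * _).
by apply: eq_bigr => i _; rewrite rmorphM.
Qed.
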